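(* Let $X=\mathbb{V}(f)\subseteq\mathbb{R}^n$ be a smooth codimension-one real algebraic variety, let $h$ be a polyhedral norm whose unit ball $B$ has set of proper faces $\mathcal{F}$, and let $I_{\mathrm{Eq}}=\bigcap_{G\in\mathcal{F}\times\mathcal{F}}I_G$ be the equidistant ideal of $X$. Let $M_X$ be the algebraic (Zariski) closure of the medial axis $\mathrm{Med}_h(X)$ in $\mathbb{R}^n$. Then $$\mathrm{Med}_h(X)\subset M_X\subset\mathbb{V}(I_{\mathrm{Eq}}).$$
   Context: Polyhedral norm: let $\mathcal{L}$ be a finite set of linear functionals on $\mathbb{R}^n$ with $\mathcal{L}=-\mathcal{L}$ such that $B=\{x\in\mathbb{R}^n\mid \ell(x)\le 1 \text{ for all }\ell\in\mathcal{L}\}$ is a bounded, full-dimensional polytope. The norm is $h(x)=\max_{\ell\in\mathcal{L}}\ell(x)$, with unit ball $B$. $\mathcal{F}$ is the set of proper nonempty faces of $B$. $\mathbb{V}(\cdot)$ denotes the real zero set in $\mathbb{R}^n$, and $f\in\mathbb{R}[x_1,\dots,x_n]$. Medial axis: $\mathrm{Med}_h(X)=\{u\in\mathbb{R}^n\mid |\arg\min_{x\in X}h(u-x)|>1\}$. For a face $F\in\mathcal{F}$ of codimension $i=n-\dim F$ in $\mathbb{R}^n$, let $\ell_1,\dots,\ell_i$ be $i$ linear functionals defining $F$, i.e. linearly independent functionals in $\mathcal{L}$ with $\ell_1=\cdots=\ell_i=1$ on $F$ (so the affine hull of $F$ is $\{\ell_1=\dots=\ell_i=1\}$). For a pair $(F_1,F_2)\in\mathcal{F}\times\mathcal{F}$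 of codimensions $i,j$, with defining functionals $\ell_1,\dots,\ell_i$ and $\hat\ell_1,\dots,\hat\ell_j$, work in $\mathbb{R}[x_1,\dots,x_n,y_1,\dots,y_n,u_1,\dots,u_n,\lambda]$. Let $J_{F_1}$ be generated by $f(x),\ \ell_1(x-u)-\lambda,\dots,\ell_i(x-u)-\lambda$ and the $(i+1)\times(i+1)$ minors of the $(i+1)\times n$ matrix with rows $\nabla_xf,\nabla_x\ell_1,\dots,\nabla_x\ell_i$. Let $J_{F_2}$ be generated by $f(y),\ \hat\ell_1(y-u)-\lambda,\dots,\hat\ell_j(y-u)-\lambda$ and the $(j+1)\times(j+1)$ minors of the $(j+1)\times n$ matrix with rows $\nabla_yf,\nabla_y\hat\ell_1,\dots,\nabla_y\hat\ell_j$. (For a vertex there are no minors.) Set $J_{(F_1,F_2)}=J_{F_1}+J_{F_2}$ and $I_{(F_1,F_2)}=J_{(F_1,F_2)}\cap\mathbb{R}[u_1,\dots,u_n]$. *)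

(* Defs.v *)
From mathcomp Require Import all_boot all_order all_algebra.
From mathcomp Require Import boolp classical_sets reals.
From mathcomp Require Import mpoly.

Set Implicit Arguments.
Unset Strict Implicit.
Unset Printing Implicit Defensive.

Import Order.TTheory GRing.Theory Num.Theory.
Local Open Scope classical_set_scope.
Local Open Scope ring_scope.

(* Points of R^n are row vectors. A linear functional on R^n is represented by
   its coefficient vector, which is also its gradient. *)

Section AffineGeometry.
Context {R : realType} {n : nat}.
Implicit Types (l x u : 'rV[R]_n) (A F : set 'rV[R]_n).

Definition app l x : R := \sum_j l 0 j * x 0 j.

Definition affine_hull A : set 'rV[R]_n :=
  [set x | exists (k : nat) (c : 'I_k -> R) (p : 'I_k -> 'rV[R]_n),
     [/\ forall i, A (p i), \sum_i c i = 1 & x = \sum_i c i *: p i]].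

Definition has_dim A (d : nat) : Prop :=
  exists (x0 : 'rV[R]_n) (V : {vspace 'rV[R]_n}),
    \dim V = d /\ affine_hull A = [set x | x - x0 \in V].

Definition is_face A F : Prop :=
  exists (a : 'rV[R]_n) (b : R),
    (forall x, A x -> app a x <= b) /\ F = A `&` [set x | app a x = b].

Definition proper_nonempty_face A F : Prop :=
  [/\ is_face A F, F !=set0 & F <> A].

End AffineGeometry.

Section PolyhedralNorm.
Context {R : realType} {n : nat}.
Variable L : seq 'rV[R]_n.

Definition unit_ball : set 'rV[R]_n :=
  [set x | forall l, l \in L -> app l x <= 1].

Definition polyhedral_norm_data : Prop :=
  [/\ forall l, l \in L -> - l \in L,
      exists M : R, forall x, unit_ball x -> forall j, `|x 0 j| <= M
    & has_dim unit_ball n].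

(* The default value 0 is harmless: when L is nonempty and L = -L, the maximum
   of the l(x) is nonnegative. *)
Definition poly_norm (x : 'rV[R]_n) : R := \big[Num.max/0]_(l <- L) app l x.

(* s lists (codim F) linearly independent elements of L equal to 1 on F. *)
Definition defining_functionals (F : set 'rV[R]_n) (s : seq 'rV[R]_n) : Prop :=
  [/\ {subset s <= L}, free s,
      forall l x, l \in s -> F x -> app l x = 1
    & exists2 d, has_dim F d & (d + size s = n)%N].

End PolyhedralNorm.

Section MedialAxis.
Context {R : realType} {n : nat}.
Variable h : 'rV[R]_n -> R.

Definition nearest_points (X : set 'rV[R]_n) (u : 'rV[R]_n) : set 'rV[R]_n :=
  [set x | X x /\ forall y, X y -> h (u - x) <= h (u - y)].

Definition medial_axis (X : set 'rV[R]_n) : set 'rV[R]_n :=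
  [set u | exists x y, [/\ nearest_points X u x, nearest_points X u y
                         & x <> y]].

End MedialAxis.

Section Varieties.
Context {R : realType} {n : nat}.
Implicit Types (X : set 'rV[R]_n) (f g : {mpoly R[n]}).

Definition zero_set (I : set {mpoly R[n]}) : set 'rV[R]_n :=
  [set x | forall p, I p -> p.@[x 0] = 0].

Definition vanishing_ideal X : set {mpoly R[n]} :=
  [set p | forall x, X x -> p.@[x 0] = 0].

Definition zariski_closure X : set 'rV[R]_n :=
  \bigcap_(I in [set I | X `<=` zero_set I]) zero_set I.

Definition gradient f (x : 'rV[R]_n) : 'rV[R]_n := \row_j (f^`M(j)).@[x 0].

(* Jacobian criterion: at every point, the gradients of the elements of the
   vanishing ideal (not just of a given set of equations) form a space of
   dimension c. As this rank is the same at every point, X is nonsingular of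
   pure codimension c. *)
Definition smooth_of_codim (c : nat) X : Prop :=
  X !=set0 /\
  forall x, X x -> exists2 N : {vspace 'rV[R]_n}, \dim N = c &
    forall v, v \in N <-> exists2 g, vanishing_ideal X g & v = gradient g x.

End Varieties.

Section Ideals.
Context {A : comNzRingType}.

Definition ideal_generated (S : set A) : set A :=
  [set p | exists (k : nat) (a s : 'I_k -> A),
     (forall i, S (s i)) /\ p = \sum_i a i * s i].

Definition ideal_sum (I J : set A) : set A :=
  [set p | exists2 a, I a & exists2 b, J b & p = a + b].

End Ideals.

Section EquidistantIdeal.
Context {R : realType} {n : nat}.

(* The 3n+1 variables x_1..x_n, y_1..y_n, u_1..u_n, lambda, in this order. *)
Definition nvars : nat := (n + n + n + 1)%N.
Definition ix (j : 'I_n) : 'I_nvars := lshift 1 (lshift n (lshift n j)).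
Definition iy (j : 'I_n) : 'I_nvars := lshift 1 (lshift n (rshift n j)).
Definition iu (j : 'I_n) : 'I_nvars := lshift 1 (rshift (n + n) j).
Definition ilam : 'I_nvars := rshift (n + n + n) ord0.

Definition rename (w : 'I_n -> 'I_nvars) (p : {mpoly R[n]}) : {mpoly R[nvars]} :=
  p \mPo [tuple 'X_(w j) | j < n].

Variables (L : seq 'rV[R]_n) (f : {mpoly R[n]}).

(* Below, w is ix or iy, and s lists the functionals defining a face. *)

Definition dist_eqn (w : 'I_n -> 'I_nvars) (l : 'rV[R]_n) : {mpoly R[nvars]} :=
  \sum_j (l 0 j)%:MP * ('X_(w j) - 'X_(iu j)) - 'X_ilam.

Definition jacobian (w : 'I_n -> 'I_nvars) (s : seq 'rV[R]_n) :
    'M[{mpoly R[nvars]}]_(1 + size s, n) :=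
  col_mx (\row_j rename w (f^`M(j)))
         (\matrix_(k < size s, j < n) ((nth 0 s k) 0 j)%:MP).

Definition maximal_minors (m : nat) (M : 'M[{mpoly R[nvars]}]_(m, n)) :
    set {mpoly R[nvars]} :=
  [set p | exists2 g : 'I_m -> 'I_n,
     {homo g : a b / (a < b)%N} & p = \det (colsub g M)].

Definition face_ideal (w : 'I_n -> 'I_nvars) (s : seq 'rV[R]_n) :
    set {mpoly R[nvars]} :=
  ideal_generated ([set rename w f]
                   `|` [set p | exists2 l, l \in s & p = dist_eqn w l]
                   `|` maximal_minors (jacobian w s)).

Definition pair_ideal (s1 s2 : seq 'rV[R]_n) : set {mpoly R[nvars]} :=
  ideal_sum (face_ideal ix s1) (face_ideal iy s2).

Definition elim_ideal (s1 s2 : seq 'rV[R]_n) : set {mpoly R[n]} :=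
  [set p | pair_ideal s1 s2 (rename iu p)].

(* ell chooses a list of defining functionals for each proper face. *)
Definition equidistant_ideal (ell : set 'rV[R]_n -> seq 'rV[R]_n) :
    set {mpoly R[n]} :=
  [set p | forall F1 F2, proper_nonempty_face (unit_ball L) F1 ->
     proper_nonempty_face (unit_ball L) F2 -> elim_ideal (ell F1) (ell F2) p].

End EquidistantIdeal.

(* Main.v *)
(* Let u be in the medial axis, x a nearest point of X and lam = h(u - x). The
   functionals that are tight at (x - u) / lam cut out a face F of B, and the
   defining functionals of F span all of them. If grad f(x) were outside this
   span, some v killed by the tight functionals would have grad f(x).v <> 0;
   moving from x towards u with a small correction along v, the intermediate
   value theorem produces a zero of f strictly closer to u. Hence the rows of
   the Jacobian matrix are dependent, its maximal minors vanish, and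
   (x, y, u, lam) is a zero of J_(F1, F2) for the faces F1, F2 given by two
   nearest points x, y. *)
Require Import Defs.
From mathcomp Require Import all_boot all_order all_algebra.
From mathcomp Require Import boolp classical_sets reals.
From mathcomp Require Import mpoly.
From mathcomp Require Import ring.

Set Implicit Arguments.
Unset Strict Implicit.
Unset Printing Implicit Defensive.

Import Order.TTheory GRing.Theory Num.Theory.
Local Open Scope classical_set_scope.
Local Open Scope ring_scope.

(** * Bilinearity of the pairing between functionals and points *)

Section Pairing.
Context {R : realType} {n : nat}.
Implicit Types l x y : 'rV[R]_n.

Lemma appE l x : app l x = (l *m x^T) 0 0.
Proof. by rewrite mxE; apply: eq_bigr => j _; rewrite mxE. Qed.

Lemma appDr l x y : app l (x + y) = app l x + app l y.
Proof. by rewrite !appE linearD mulmxDr mxE. Qed.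

Lemma appZr l a x : app l (a *: x) = a * app l x.
Proof. by rewrite !appE linearZ -scalemxAr mxE. Qed.

Lemma appNr l x : app l (- x) = - app l x.
Proof. by rewrite -scaleN1r appZr mulN1r. Qed.

Lemma appNl l x : app (- l) x = - app l x.
Proof. by rewrite !appE mulNmx mxE. Qed.

Lemma app0r l : app l 0 = 0.
Proof. by rewrite -(scale0r 0) appZr mul0r. Qed.

Lemma app_sumr l (I : Type) (r : seq I) (F : I -> 'rV[R]_n) :
  app l (\sum_(i <- r) F i) = \sum_(i <- r) app l (F i).
Proof. exact: (big_morph (app l) (appDr l) (app0r l)). Qed.

Lemma app_suml (r : seq 'rV[R]_n) x :
  app (\sum_(l <- r) l) x = \sum_(l <- r) app l x.
Proof.
by apply: (big_morph (app^~ x)) => [l l'|];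
   rewrite !appE ?mulmxDl ?mul0mx mxE.
Qed.

End Pairing.

(** * Strict inequalities valid on a right neighbourhood of 0 *)

Section RightNeighbourhoods.
Context {R : realType}.
Implicit Types p : {poly R}.

(** Write [p = q * 'X + p.[0]]; a bound on [q] over the unit disk keeps [q.[t] * t] smaller than
    [p.[0]] in absolute value for small [t]. *)
Lemma poly_gt0_near p : 0 < p.[0] ->
  exists2 e, 0 < e & forall t, 0 < t < e -> 0 < p.[t].
Proof.
move=> p0; have [|q qE] := factor_theorem (p - p.[0]%:P) 0 _.
  by rewrite /root !hornerE subrr.
have [M HM] := poly_disk_bound q 1.
(* The 1 keeps [t] in the disk where [M] bounds [q]; [|M| + 1] is a bound that is surely
   positive. *)
exists (Num.min 1 (p.[0] / (`|M| + 1))) => [|t /andP[t0]].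
  by rewrite lt_min ltr01 divr_gt0 // ltr_wpDl.
rewrite lt_min ltr_pdivlMr ?ltr_wpDl// => /andP[t1 tM].
have -> : p.[t] = q.[t] * t + p.[0].
  move/(congr1 (horner^~ t)): qE; rewrite /= !hornerE subr0 => <-.
  by rewrite subrK.
rewrite -ltrBlDr sub0r; suff : - (q.[t] * t) < p.[0] by rewrite ltrNl.
apply: le_lt_trans tM; rewrite mulrC -mulrN ler_pM2l //.
apply: (le_trans (ler_norm _)); rewrite normrN.
have /HM/le_trans : `|t| <= 1 by rewrite gtr0_norm // ltW.
by apply; rewrite (le_trans (ler_norm M)) // lerDl.
Qed.

Lemma poly_gt0_right p : p.[0] = 0 -> 0 < p^`().[0] ->
  exists2 e, 0 < e & forall t, 0 < t < e -> 0 < p.[t].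
Proof.
move=> /eqP/factor_theorem[q ->]; rewrite subr0 derivM derivX !hornerE.
rewrite ?mulr0 ?add0r => /poly_gt0_near[e e0 He]; exists e => // t te.
by rewrite !hornerE mulr_gt0 ?He //; case/andP: te.
Qed.

(** The two cases are a slack constraint and a tight one along a direction that decreases it. *)
Lemma ltr_near_right (a b c : R) : a < c \/ a = c /\ b < 0 ->
  exists2 e, 0 < e & forall t, 0 < t < e -> a + t * b < c.
Proof.
move=> abc.
have pE t : ((c - a)%:P - b *: 'X).[t] = c - a - b * t by rewrite !hornerE.
have [e e0 He] : exists2 e, 0 < e &
    forall t, 0 < t < e -> 0 < ((c - a)%:P - b *: 'X).[t].
  case: abc => [ac|[ac b0]].
    by apply: poly_gt0_near; rewrite pE mulr0 subr0 subr_gt0.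
  by exists 1 => // t /andP[t0 _];
     rewrite pE ac subrr sub0r oppr_gt0 nmulr_rlt0.
exists e => // t /He; rewrite pE -addrA -opprD subr_gt0.
by rewrite (mulrC b).
Qed.

Lemma all_near_right (T : eqType) (s : seq T) (P : T -> R -> Prop) :
  (forall l, l \in s -> exists2 e, 0 < e & forall t, 0 < t < e -> P l t) ->
  exists2 e, 0 < e & forall t, 0 < t < e -> forall l, l \in s -> P l t.
Proof.
elim: s => [|a s IH] H; first by exists 1.
have [|e1 e10 H1] := IH _; first by move=> l ls; apply: H; rewrite inE ls orbT.
have [|e2 e20 H2] := H a _; first by rewrite inE eqxx.
exists (Num.min e1 e2) => [|t]; first by rewrite lt_min e10.
rewrite lt_min => /and3P[t0 t1 t2] l; rewrite inE => /orP[/eqP->|].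
  by apply: H2; rewrite t0.
by apply: H1; rewrite t0.
Qed.

Lemma near_right_and (P Q : R -> Prop) :
  (exists2 e, 0 < e & forall t, 0 < t < e -> P t) ->
  (exists2 e, 0 < e & forall t, 0 < t < e -> Q t) ->
  exists2 e, 0 < e & forall t, 0 < t < e -> P t /\ Q t.
Proof.
move=> HP HQ.
have [|e e0 He] := @all_near_right bool [:: true; false]
  (fun b t => if b then P t else Q t); first by case.
by exists e => // t /He H; split; [apply: (H true)|apply: (H false)].
Qed.

End RightNeighbourhoods.

(** * Restriction of polynomials to lines, and descent along a hypersurface *)

Section Restriction.
Context {R : realType} {n : nat}.
Implicit Types (f g : {mpoly R[n]}) (x w : 'rV[R]_n).

(** Built as a univariate polynomial, so that the formal derivative and the intermediate value
    theorem for polynomials apply. *)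
Definition line_restriction x w f : {poly R} :=
  mmap polyC (fun j => (x 0 j)%:P + w 0 j *: 'X) f.

Lemma line_restrictionE x w f t :
  (line_restriction x w f).[t] = f.@[(x + t *: w) 0].
Proof.
rewrite /line_restriction [f]mpolyE !raddf_sum horner_sum /=.
apply: eq_bigr => m _; rewrite !mmapZ /= mmapX mevalZ mevalX.
rewrite hornerM hornerC; congr (_ * _).
rewrite /mmap1 horner_prod; apply: eq_bigr => j _.
by rewrite horner_exp !hornerE !mxE (mulrC t).
Qed.

(* Both sides are derivations in [f], so they agree once they agree on the
   variables. *)
Lemma deriv_line_restriction x w f :
  (line_restriction x w f)^`().[0] = app (gradient f x) w.
Proof.
pose P f := (line_restriction x w f)^`().[0] = app (gradient f x) w.
have appGE g : app (gradient g x) w = \sum_j (g^`M(j)).@[x 0] * w 0 j.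
  by apply: eq_bigr => j _; rewrite mxE.
have P1 : P 1.
  rewrite /P /line_restriction rmorph1 derivC horner0 appGE big1 // => j _.
  by rewrite -mpolyC1 mderivC meval0 mul0r.
have PM g h : P g -> P h -> P (g * h).
  rewrite /P /line_restriction rmorphM derivM !hornerE => -> ->.
  rewrite -!/(line_restriction x w _) !line_restrictionE !scale0r !addr0.
  rewrite !appGE mulr_suml mulr_sumr -big_split /=.
  apply: eq_bigr => j _; rewrite mderivM mevalD !mevalM.
  by rewrite mulrDl mulrAC -!mulrA.
have PX i : P 'X_i.
  rewrite /P /line_restriction mmapX mmap1U derivD derivC derivZ derivX add0r.
  have UU : (U_(i) - U_(i))%MM = 0%MM.
    by apply/mnmP => k; rewrite mnmBE subnn mnm0E.
  rewrite !hornerE appGE (bigD1 i) //= big1 => [|j ji].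
    by rewrite mderivX mnmE eqxx scale1r UU mpolyX0 meval1 mul1r addr0.
  by rewrite mderivX mnmE eq_sym (negPf ji) scale0r meval0 mul0r.
elim/mpolyind: f => [|c m f _ _ IH].
  rewrite /line_restriction raddf0 deriv0 horner0 appGE big1 // => j _.
  by rewrite mderiv0 meval0 mul0r.
have {P1 PM PX} PXm : P 'X_[m].
  rewrite mpolyXE_id; apply: (big_ind P) => // i _.
  by elim: (m i) => [|k IHk]; rewrite ?expr0 // exprS; apply: PM.
have -> : line_restriction x w (c *: 'X_[m] + f) =
    c *: line_restriction x w 'X_[m] + line_restriction x w f.
  by rewrite /line_restriction raddfD /= mmapZ mul_polyC.
rewrite derivD derivZ hornerD hornerZ PXm IH !appGE mulr_sumr -big_split /=.
apply: eq_bigr => j _.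
by rewrite mderivD mderivZ mevalD mevalZ mulrDl mulrA.
Qed.

(* If [v] is tangent to the active constraints but transverse to [f = 0], the
   directions [w + s *: v] point into the polytope and [s] can be tuned so that
   [f] vanishes along the way. *)
Lemma transverse_descent (L : seq 'rV[R]_n) f (u x w v : 'rV[R]_n) (lam : R) :
    f.@[x 0] = 0 -> app (gradient f x) v != 0 ->
    (forall l, l \in L -> app l (x - u) < lam \/
       [/\ app l (x - u) = lam, app l w < 0 & app l v = 0]) ->
  exists2 x' : 'rV[R]_n, f.@[x' 0] = 0 &
    forall l, l \in L -> app l (x' - u) < lam.
Proof.
move=> fx Dv HL; set D := app _ v in Dv.
(* The direction [w + c *: v] is tangent to [f = 0]; shifting [c] by [D] or [- D] makes the
   derivative of [f] equal to [D * D] or [- (D * D)]. *)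
pose c := - app (gradient f x) w / D.
pose w1 := w + (c + D) *: v; pose w2 := w + (c - D) *: v.
have DD : 0 < D * D by rewrite -expr2 exprn_even_gt0.
have cD : c * D = - app (gradient f x) w by rewrite mulfVK.
have g1 : app (gradient f x) w1 = D * D.
  by rewrite appDr appZr -/D mulrDl cD addrA subrr add0r.
have g2 : app (gradient f x) w2 = - (D * D).
  by rewrite appDr appZr -/D mulrBl cD addrA subrr add0r.
have inside k : exists2 e, 0 < e & forall t, 0 < t < e ->
    forall l, l \in L -> app l (x + t *: (w + k *: v) - u) < lam.
  apply: all_near_right => l /HL lL.
  have [|e e0 He] := @ltr_near_right R (app l (x - u)) (app l (w + k *: v)) lam.
    case: lL => [|[-> lw lv]]; [by left|right; split=> //].
    by rewrite appDr appZr lv mulr0 addr0.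
  by exists e => // t /He; congr (_ < _); rewrite addrAC [RHS]appDr appZr.
have pos1 : exists2 e, 0 < e & forall t, 0 < t < e ->
    0 < f.@[(x + t *: w1) 0].
  have [||e e0 He] := @poly_gt0_right R (line_restriction x w1 f).
  - by rewrite line_restrictionE scale0r addr0.
  - by rewrite deriv_line_restriction g1.
  by exists e => // t /He; rewrite line_restrictionE.
have neg2 : exists2 e, 0 < e & forall t, 0 < t < e ->
    f.@[(x + t *: w2) 0] < 0.
  have [||e e0 He] := @poly_gt0_right R (- line_restriction x w2 f).
  - by rewrite hornerN line_restrictionE scale0r addr0 fx oppr0.
  - by rewrite derivN hornerN deriv_line_restriction g2 opprK.
  by exists e => // t /He; rewrite hornerN line_restrictionE oppr_gt0.
have [e e0 He] := near_right_and
  (near_right_and pos1 neg2)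
  (near_right_and (inside (c + D)) (inside (c - D))).
have [|[f1 f2] [i1 i2]] := He (e / 2).
  by rewrite divr_gt0 //= gtr_pMr // invf_lt1 // ltr1n.
move: (e / 2) f1 f2 i1 i2 => t f1 f2 i1 i2.
(* On the segment from [x + t *: w2] to [x + t *: w1], [f] passes from negative to positive. *)
have [|s /andP[s0 s1]] := @poly_ivt R
  (line_restriction (x + t *: w2) (t *: (w1 - w2)) f) 0 1 ler01.
  rewrite !line_restrictionE scale0r addr0 scale1r ltW //=.
  by rewrite -addrA -scalerDr [w2 + _]addrCA subrr addr0 ltW.
rewrite /root line_restrictionE => /eqP fs.
exists (x + t *: w2 + s *: (t *: (w1 - w2))) => // l lL.
move: (i1 l lL) (i2 l lL); rewrite -/w1 -/w2.
clear -s0 s1; clearbody w1 w2.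
rewrite !(appDr, appZr, appNr); move: (app l x) (app l u) => a b.
move: (app l w1) (app l w2) => a1 a2 h1 h2.
(* The zero is a convex combination of two points satisfying all strict inequalities. The case
   [s = 0] is apart because strictness is taken from the term of weight [s]. *)
have -> : a + t * a2 + s * (t * (a1 - a2)) - b =
    s * (a + t * a1 - b) + (1 - s) * (a + t * a2 - b).
  by ring.
have -> : lam = s * lam + (1 - s) * lam by rewrite -mulrDl addrC subrK mul1r.
have [->|sn0] := eqVneq s 0; first by rewrite !mul0r !add0r subr0 !mul1r.
apply: ltr_leD; first by rewrite ltr_pM2l // lt_neqAle eq_sym sn0.
by rewrite ler_wpM2l ?subr_ge0 // ltW.
Qed.

End Restriction.

(** * The polyhedral norm and the faces of its unit ball *)

Section Norm.
Context {R : realType} {n : nat}.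
Variable L : seq 'rV[R]_n.
Implicit Types l x y z u v : 'rV[R]_n.

Lemma le_poly_norm l x : l \in L -> app l x <= poly_norm L x.
Proof. by move=> lL; exact: (le_bigmax_seq 0 l xpredT (app^~ x)). Qed.

Lemma poly_norm_ge0 x : 0 <= poly_norm L x.
Proof.
rewrite /poly_norm; elim/big_rec: _ => // l y _ y0.
by rewrite le_max y0 orbT.
Qed.

(** Positivity of [c] covers the default value 0 of the maximum. *)
Lemma poly_norm_lt x c : 0 < c -> (forall l, l \in L -> app l x < c) ->
  poly_norm L x < c.
Proof.
move=> c0 H; rewrite /poly_norm big_seq.
by elim/big_rec: _ => // l y /H lc yc; rewrite gt_max lc.
Qed.

Lemma poly_norm_attained x : 0 < poly_norm L x ->
  exists2 l, l \in L & app l x = poly_norm L x.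
Proof.
move=> h0; apply: contrapT => H.
suff : poly_norm L x < poly_norm L x by rewrite ltxx.
apply: poly_norm_lt => // l lL; rewrite lt_neqAle le_poly_norm // andbT.
by apply/eqP => E; apply: H; exists l.
Qed.

Hypothesis hL : polyhedral_norm_data L.

Lemma poly_normN x : poly_norm L (- x) = poly_norm L x.
Proof.
case: hL => LN _ _.
suff H y : poly_norm L (- y) <= poly_norm L y.
  by apply/eqP; rewrite eq_le H -{1}[x]opprK H.
have [/poly_norm_attained[l lL <-]|] := ltP 0 (poly_norm L (- y)).
  by rewrite appNr -appNl le_poly_norm // LN.
by move/le_trans; apply; apply: poly_norm_ge0.
Qed.

(** If the norm of [x] were 0, the unit ball would contain the whole ray through [x], against
    boundedness. *)
Lemma poly_norm_gt0 x : x != 0 -> 0 < poly_norm L x.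
Proof.
case: hL => _ [M HM] _ x0; rewrite lt_def poly_norm_ge0 andbT.
apply/eqP => h0; move/eqP: x0; apply; apply/rowP => j; rewrite mxE.
apply/eqP; apply: contraT => xj.
(* The scaling gives the [j]-th coordinate absolute value [|M| + 1], beyond the bound. *)
have /HM/(_ j) : unit_ball L (((`|M| + 1) / `|x 0 j|) *: x).
  move=> l /(le_poly_norm x); rewrite h0 appZr => lx.
  by rewrite (le_trans _ ler01) // mulr_ge0_le0 // divr_ge0 // addr_ge0.
rewrite mxE normrM normrM normfV normr_id mulfVK ?normr_eq0 // => H.
have : `|M| + 1 <= `|M|.
  by rewrite (le_trans (ler_norm _)) // (le_trans H) // ler_norm.
by rewrite gerDl ler10.
Qed.

(** The sum of the functionals tight at [z] supports the face: on the ball it is at most their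
    number, with equality only where each of them is 1. *)
Lemma tight_face z l0 : unit_ball L z -> l0 \in L -> app l0 z = 1 ->
  proper_nonempty_face (unit_ball L)
    [set y | unit_ball L y /\
             forall l, l \in L -> app l z = 1 -> app l y = 1].
Proof.
move=> Bz l0L l0z; set F := mkset _.
pose T := [seq l <- L | app l z == 1].
have sizeT : \sum_(l <- T) 1 = (size T)%:R :> R.
  by rewrite big_const_seq count_predT iter_addr addr0.
split.
- exists (\sum_(l <- T) l), (size T)%:R; split => [y By|].
    rewrite app_suml -sizeT big_seq [leRHS]big_seq ler_sum // => l.
    by rewrite mem_filter => /andP[_ /By].
  apply/seteqP; split=> y /= [By Hy]; split=> //.
    rewrite app_suml -sizeT big_seq [RHS]big_seq; apply: eq_bigr => l.
    by rewrite mem_filter => /andP[/eqP lz lL]; apply: Hy.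
  move=> l lL lz; apply/eqP; apply: contraT => ly.
  have lT : l \in T by rewrite mem_filter lz eqxx.
  suff : app (\sum_(l <- T) l) y < (size T)%:R by rewrite Hy ltxx.
  rewrite app_suml -sizeT !(big_rem l lT) /=; apply: ltr_leD.
    by rewrite lt_neqAle ly By.
  rewrite big_seq [leRHS]big_seq ler_sum // => k /mem_rem.
  by rewrite mem_filter => /andP[_ /By].
- by exists z.
(* The origin lies in the ball, but [l0] vanishes there. *)
- move=> FB; have : F 0.
    by rewrite FB => l _; rewrite app0r ler01.
  by move=> [_ /(_ l0 l0L l0z)] /eqP; rewrite app0r eq_sym oner_eq0.
Qed.

End Norm.

(** * Spans, common kernels and vanishing minors *)

Section LinearAlgebra.
Context {R : realType} {n : nat}.
Implicit Types (l v g z : 'rV[R]_n) (s : seq 'rV[R]_n).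

Definition seq_mx s : 'M[R]_(size s, n) := \matrix_(k, j) (nth 0 s k) 0 j.

Lemma row_seq_mx s k : row k (seq_mx s) = nth 0 s k.
Proof. by apply/rowP => j; rewrite !mxE. Qed.

Lemma free_row_free s : free s -> row_free (seq_mx s).
Proof.
move=> /(@freeP _ _ _ (in_tuple s)) sf; apply: inj_row_free => c.
rewrite mulmx_sum_row => c0; apply/rowP => k; rewrite mxE; apply: sf => {k}.
by rewrite -[RHS]c0; apply: eq_bigr => k _; rewrite row_seq_mx.
Qed.

Lemma app_seq_mx s v : (forall l, l \in s -> app l v = 0) <->
  v *m (seq_mx s)^T = 0.
Proof.
have E (k : 'I_(size s)) : (v *m (seq_mx s)^T) 0 k = app (nth 0 s k) v.
  by rewrite mxE; apply: eq_bigr => j _; rewrite !mxE mulrC.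
split=> [H|H l ls].
  by apply/rowP => k; rewrite E mxE H // mem_nth.
have ks : (index l s < size s)%N by rewrite index_mem.
by have := E (Ordinal ks); rewrite H mxE /= nth_index // => <-.
Qed.

(** A row outside the row space is detected by some column of the cokernel matrix, and that column
    is the separating vector. *)
Lemma span_or_separated s g :
  (g <= seq_mx s)%MS \/
  exists2 v, forall l, l \in s -> app l v = 0 & app g v != 0.
Proof.
have [|] := boolP (g <= seq_mx s)%MS; [by left|rewrite submxE => gs; right].
have [j gj] : exists j, (g *m cokermx (seq_mx s)) 0 j != 0.
  apply: contrapT => H; move/eqP: gs; apply; apply/rowP => j; rewrite [RHS]mxE.
  by apply/eqP; apply: contraT => Hj; case: H; exists j.
exists (col j (cokermx (seq_mx s)))^T.
  apply/app_seq_mx; rewrite -trmx_mul colE mulmxA mulmx_coker.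
  by rewrite mul0mx trmx0.
by rewrite appE trmxK colE mulmxA -colE mxE.
Qed.

(* A dimension count makes the direction of the affine hull of [F] equal to the
   common kernel of [s]. *)
Lemma app_defining_functionals (L : seq 'rV[R]_n) (F : set 'rV[R]_n) s l v :
    defining_functionals L F s -> F !=set0 ->
    (forall y, F y -> app l y = 1) -> (forall k, k \in s -> app k v = 0) ->
  app l v = 0.
Proof.
move=> [_ sf s1 [d [x0 [V [dV hullF]]] dn]] [z Fz] lF sv.
have hull1 k y : (forall y, F y -> app k y = 1) -> affine_hull F y ->
    app k y = 1.
  move=> kF [m [c [p [Fp c1 ->]]]]; rewrite app_sumr -[RHS]c1.
  by apply: eq_bigr => i _; rewrite appZr kF // mulr1.
have inhull y : (affine_hull F y : Prop) = (y - x0 \in V).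
  by rewrite hullF.
have hz : z - x0 \in V.
  rewrite -inhull; exists 1%N, (fun=> 1), (fun=> z); split=> //.
    by rewrite big_ord1.
  by rewrite big_ord1 scale1r.
(* Translating [z] by [w] stays in the affine hull, where [k] is constantly 1. *)
have Vapp k w : (forall y, F y -> app k y = 1) -> w \in V -> app k w = 0.
  move=> kF wV; have : affine_hull F (z + w).
    by rewrite inhull addrAC rpredD.
  move/(hull1 _ _ kF); rewrite appDr kF // => /eqP.
  by rewrite -subr_eq0 addrAC subrr add0r => /eqP.
apply: (Vapp _ _ lF).
pose B := \matrix_(i < \dim V) (vbasis V)`_i.
have Brow i : row i B = (vbasis V)`_i by rewrite rowK.
have Bfree : row_free B.
  apply: inj_row_free => c; rewrite mulmx_sum_row => c0.
  apply/rowP => i; rewrite mxE.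
  apply: (freeP (basis_free (vbasisP V))) => //.
  by rewrite -[RHS]c0; apply: eq_bigr => k _; rewrite Brow.
have BV (i : 'I_(\dim V)) : (vbasis V)`_i \in V.
  by rewrite vbasis_mem // mem_nth // size_tuple.
have BK : (B <= kermx (seq_mx s)^T)%MS.
  apply/row_subP => i; apply/sub_kermxP; rewrite Brow; apply/app_seq_mx => k ks.
  by apply: Vapp => // y; apply: s1.
have /eqmxP/eqmx_sym KB : (B == kermx (seq_mx s)^T)%MS.
  rewrite -(geq_leqif (mxrank_leqif_eq BK)) mxrank_ker mxrank_tr.
  move/eqP: (free_row_free sf) => ->; move/eqP: Bfree => ->.
  by rewrite dV leq_subLR addnC dn.
have : (v <= B)%MS by rewrite -KB; apply/sub_kermxP/app_seq_mx.
case/submxP => c ->; rewrite mulmx_sum_row rpred_sum // => i _.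
by rewrite rpredZ // Brow BV.
Qed.

Lemma det_colsub_dependent m (g : 'rV[R]_n) (S : 'M[R]_(m, n))
    (h : 'I_(1 + m) -> 'I_n) :
  (g <= S)%MS -> \det (colsub h (col_mx g S)) = 0.
Proof.
case/submxP => c gS; apply/eqP/det0P; exists (row_mx 1%:M (- c)).
  apply/eqP => /rowP/(_ (lshift m 0)); rewrite row_mxEl !mxE eqxx => /eqP.
  by rewrite oner_eq0.
rewrite mulmx_colsub mul_row_col mul1mx mulNmx -gS subrr.
by apply/rowP => j; rewrite !mxE.
Qed.

End LinearAlgebra.

(** * Evaluation of the generators of a face ideal *)

Section FaceIdeal.
Context {R : realType} {n : nat}.
Variables (f : {mpoly R[n]}) (w : 'I_n -> 'I_(@nvars n)).
Variables (ev : 'I_(@nvars n) -> R) (x u : 'rV[R]_n) (lam : R).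
Hypotheses (ev_w : forall j, ev (w j) = x 0 j)
  (ev_u : forall j, ev (iu j) = u 0 j) (ev_lam : ev ilam = lam).

Lemma meval_rename (w' : 'I_n -> 'I_(@nvars n)) (y : 'rV[R]_n) p :
  (forall j, ev (w' j) = y 0 j) -> (rename w' p).@[ev] = p.@[y 0].
Proof.
move=> H; rewrite comp_mpoly_meval; apply: meval_eq => j.
by rewrite tnth_mktuple mevalXU.
Qed.

Lemma meval_dist_eqn l : (dist_eqn w l).@[ev] = app l (x - u) - lam.
Proof.
rewrite mevalB mevalXU ev_lam; congr (_ - _).
rewrite raddf_sum; apply: eq_bigr => j _ /=.
by rewrite mevalM mevalC mevalB !mevalXU ev_w ev_u !mxE.
Qed.

Lemma meval_ideal_generated (S : set {mpoly R[@nvars n]}) p :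
  (forall q, S q -> q.@[ev] = 0) -> ideal_generated S p -> p.@[ev] = 0.
Proof.
move=> H [k [a [s [Ss ->]]]]; rewrite raddf_sum big1 // => i _ /=.
by rewrite mevalM (H _ (Ss i)) mulr0.
Qed.

Lemma meval_face_ideal s p :
    f.@[x 0] = 0 -> (forall l, l \in s -> app l (x - u) = lam) ->
    (gradient f x <= seq_mx s)%MS -> face_ideal f w s p -> p.@[ev] = 0.
Proof.
move=> fx sl gs; apply: meval_ideal_generated => q.
case=> [[->|[l ls ->]]|[h _ ->]].
- by rewrite (meval_rename _ ev_w).
- by rewrite meval_dist_eqn sl // subrr.
(* Evaluation commutes with minors and turns the Jacobian into [gradient f x] stacked on
   [seq_mx s]. *)
rewrite -det_map_mx map_mxsub -[RHS](det_colsub_dependent h gs).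
congr (\det (colsub _ _)); rewrite map_col_mx; congr col_mx.
  by apply/rowP => j; rewrite !mxE /= (meval_rename _ ev_w).
by apply/matrixP => k j; rewrite !mxE /= mevalC.
Qed.

End FaceIdeal.

(** * First-order condition at a nearest point *)

Section Nearest.
Context {R : realType} {n : nat}.
Variables (L : seq 'rV[R]_n) (ell : set 'rV[R]_n -> seq 'rV[R]_n).
Variable f : {mpoly R[n]}.
Hypotheses (hL : polyhedral_norm_data L)
  (hell : forall F, proper_nonempty_face (unit_ball L) F ->
     defining_functionals L F (ell F)).

Lemma nearest_point_face u x :
    nearest_points (poly_norm L) (zero_set [set f]) u x -> u != x ->
  exists2 F, proper_nonempty_face (unit_ball L) F &
    (forall l, l \in ell F -> app l (x - u) = poly_norm L (u - x)) /\
    (gradient f x <= seq_mx (ell F))%MS.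
Proof.
move=> [fx xmin] ux; set lam := poly_norm L (u - x).
have lam0 : 0 < lam by rewrite poly_norm_gt0 // subr_eq0.
have hxu : poly_norm L (x - u) = lam by rewrite -opprB poly_normN.
(* This is the direction from [u] to [x] scaled to the unit sphere; the sign matches [dist_eqn]. *)
pose z := lam^-1 *: (x - u).
have appz l : app l z = 1 <-> app l (x - u) = lam.
  rewrite appZr mulrC; split=> [|->]; last by rewrite mulfV ?gt_eqF.
  by move/divr1_eq.
have Bz : unit_ball L z.
  move=> l /(le_poly_norm (x - u)); rewrite hxu => H.
  by rewrite appZr mulrC ler_pdivrMr // mul1r.
have [l0 l0L l0z] : exists2 l, l \in L & app l z = 1.
  have [|l lL E] := @poly_norm_attained _ _ L (x - u); first by rewrite hxu.
  by exists l => //; apply/appz; rewrite E.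
have Fface := tight_face Bz l0L l0z; move: Fface; set F := mkset _ => Fface.
have Fz : F z by [].
exists F => //; have [sL _ s1 _] := hell Fface.
split=> [l lF|]; first by apply/appz/s1.
have [//|[v sv gv]] := span_or_separated (ell F) (gradient f x).
(* Every tight functional takes the value [- lam < 0] on [u - x], so moving towards [u] is a strict
   descent. *)
have [||x' fx' x'lt] := @transverse_descent _ _ L f u x (u - x) v lam _ gv.
- exact: fx.
- move=> l lL; have := le_poly_norm (x - u) lL.
  rewrite hxu le_eqVlt => /orP[/eqP E|]; [right|by left]; split=> //.
    by rewrite -opprB appNr E oppr_lt0.
  apply: (app_defining_functionals (hell Fface)) sv; first by exists z.
  by move=> y [_]; apply=> //; apply/appz.
have : poly_norm L (u - x') < lam.
  by rewrite -opprB poly_normN // poly_norm_lt.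
by rewrite ltNge xmin // => p ->.
Qed.

End Nearest.

Theorem theorem5p5 (R : realType) (n : nat) (L : seq 'rV[R]_n)
    (hL : polyhedral_norm_data L)
    (ell : set 'rV[R]_n -> seq 'rV[R]_n)
    (hell : forall F, proper_nonempty_face (unit_ball L) F ->
       defining_functionals L F (ell F))
    (f : {mpoly R[n]})
    (hX : smooth_of_codim 1 (zero_set [set f])) :
  let Med := medial_axis (poly_norm L) (zero_set [set f]) in
  let M_X := zariski_closure Med in
  Med `<=` M_X /\ M_X `<=` zero_set (equidistant_ideal L f ell).
Proof.
move=> Med M_X; split=> [u Mu I|]; first exact.
(* A zero set containing [Med] is one of those intersected in the closure. *)
suff H : Med `<=` zero_set (equidistant_ideal L f ell) by move=> u; apply.
move=> u [x [y [nx ny xy]]] p pI.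
have hxy : poly_norm L (u - x) = poly_norm L (u - y).
  by apply/eqP; rewrite eq_le (nx.2 y ny.1) (ny.2 x nx.1).
(* If [u] were one of the two points, both distances would be 0 and the points would coincide. *)
have neq_u x1 x2 :
    poly_norm L (u - x1) = poly_norm L (u - x2) -> x1 <> x2 -> u != x1.
  move=> E N; apply/eqP => ux; subst x1; apply: N; apply/eqP.
  rewrite -subr_eq0; apply: contraT => /(poly_norm_gt0 hL).
  rewrite -E subrr => h0; have [l _] := poly_norm_attained h0.
  by rewrite app0r => h00; rewrite -h00 ltxx in h0.
have [F1 F1face [d1 g1]] :=
  nearest_point_face hL hell nx (neq_u _ _ hxy xy).
have [F2 F2face [d2 g2]] :=
  nearest_point_face hL hell ny (neq_u _ _ (esym hxy) (nesym xy)).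
(* The point [(x, y, u, lam)], in the variable order of [nvars]; both summands of [pair_ideal]
   vanish there. *)
pose ev : 'I_(@nvars n) -> R := row_mx (row_mx (row_mx x y) u)
  (poly_norm L (u - x))%:M 0.
have ev_x j : ev (ix j) = x 0 j by rewrite /ev !row_mxEl.
have ev_y j : ev (iy j) = y 0 j by rewrite /ev !row_mxEl row_mxEr.
have ev_u j : ev (iu j) = u 0 j by rewrite /ev row_mxEl row_mxEr.
have ev_lam : ev ilam = poly_norm L (u - x) by rewrite /ev row_mxEr mxE.
have [a a1 [b b2 ab]] := pI F1 F2 F1face F2face.
rewrite -(meval_rename _ ev_u) ab mevalD.
rewrite (meval_face_ideal ev_x ev_u ev_lam _ d1 g1 a1) ?add0r; last exact: nx.1.
by apply: (meval_face_ideal ev_y ev_u ev_lam _ _ g2 b2);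
   [exact: ny.1|rewrite hxy].
Qed.
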